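(* In genus $1$, up to the space of degree $24$, $$\mathfrak{D}^{(1)}=\mathfrak{A}^{(1)}=\mathfrak{B}^{(1)},$$ that is, $\mathfrak{D}^{(1)}_{\le 24}=\mathfrak{A}^{(1)}_{\le 24}=\mathfrak{B}^{(1)}_{\le 24}$.
   Context: A binary code of length $n$ is a linear subspace of $\mathbb{F}_2^n$ with inner product $u\cdot v=\sum_i u_iv_i$; it is self-dual if it equals its dual. A Type II code is a binary self-dual code all of whose codewords have weight (number of nonzero coordinates) divisible by $4$. Two self-dual codes of length $n$ are neighbors if their intersection has dimension $\frac n2-1$. For $n\equiv 0\pmod 8$, $d_n^+$ is the Type II code of length $n$ spanned by the vectors with support $\{1,2,2i-1,2i\}$ for $2\le i\le n/2$, together with the vector $(1,0,1,0,\dots,1,0)$. For a Type II code $C$ of length $n$, its weight enumerator in genus $g$ is the homogeneous polynomial of degree $n$ in the $2^g$ variables $x_a$ ($a\in\mathbb{F}_2^g$, written as column vectors) $$W_C^{(g)}(x_a : a\in\mathbb{F}_2^g)=\sum_{u_1,\dots,u_g\in C}\ \prod_{a\in\mathbb{F}_2^g}x_a^{n_a(u_1,\dots,u_g)},$$ where $n_a(u_1,\dots,u_g)$ is the number of $i\in\{1,\dots,n\}$ with $(u_{1i},\dots,u_{gi})^T=a$. Define the following $\mathbb{C}$-subalgebras of $\mathbb{C}[x_a : a\in\mathbb{F}_2^g]$: $\mathfrak{B}^{(g)}$ is generated by all $W_C^{(g)}$ with $C$ a Type II code (of any length); $\mathfrak{D}^{(g)}$ is generated by all $W_{d_n^+}^{(g)}$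 with $n>0$, $n\equiv0\pmod 8$; $\mathfrak{A}^{(g)}$ is generated by all $W_C^{(g)}$ where, for some positive $n\equiv0\pmod 8$, $C$ is $d_n^+$ or a Type II neighbor of $d_n^+$. These are graded by degree; for such a ring $R$, $R_{\le 24}$ denotes the direct sum of its homogeneous components of degree at most $24$. *)

(* Defs.v *)
From HB Require Import structures.
From mathcomp Require Import all_boot all_order all_algebra.
From mathcomp Require Import complex mpoly.
From mathcomp Require Import reals.

Set Implicit Arguments.
Unset Strict Implicit.
Unset Printing Implicit Defensive.

Import GRing.Theory.
Local Open Scope ring_scope.

Section Codes.

Variable n : nat.
Implicit Types (u v : 'rV['F_2]_n) (C D : {vspace 'rV['F_2]_n}).

Definition dotp u v : 'F_2 := \sum_(i < n) u 0 i * v 0 i.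

Definition wt u : nat := #|[set i : 'I_n | u 0 i != 0]|.

Definition dual_code C : {set 'rV['F_2]_n} :=
  [set u | [forall v, (v \in C) ==> (dotp u v == 0)]].

Definition self_dual C : Prop := [set u | u \in C] = dual_code C.

Definition type_II C : Prop :=
  self_dual C /\ (forall u, u \in C -> (4 %| wt u)%N).

(* The dimension of the intersection is n/2 - 1, written without truncated
   subtraction; a self-dual code has even length, so n./2 is exact. *)
Definition neighbors C D : Prop :=
  [/\ self_dual C, self_dual D & (\dim (C :&: D)%VS).+1 = n./2].

(* Coordinates are numbered from 1 in supports: j : 'I_n is coordinate j.+1. *)
Definition dplus_row (i : nat) : 'rV['F_2]_n :=
  \row_(j < n) (j.+1 \in [:: 1; 2; (2 * i).-1; 2 * i]%N)%:R.

Definition dplus_glue : 'rV['F_2]_n := \row_(j < n) (odd j.+1)%:R.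

Definition dplus : {vspace 'rV['F_2]_n} :=
  <<dplus_glue :: [seq dplus_row i | i <- index_iota 2 n./2.+1]>>%VS.

End Codes.

Arguments dplus n : clear implicits.

(* C[x_a : a in F_2^g]; the variable x_a is the one of index enum_rank a. *)
Notation enum_ring R g := {mpoly (complex R)[#|{: 'cV['F_2]_g}|]}.

Section Rings.

Variables (R : realType) (g : nat).
Implicit Types (p : enum_ring R g) (S A : enum_ring R g -> Prop).

Definition count_col n (u : {ffun 'I_g -> 'rV['F_2]_n}) (a : 'cV['F_2]_g) : nat :=
  #|[set i : 'I_n | \col_(k < g) u k 0 i == a]|.

Definition weight_enum n (C : {vspace 'rV['F_2]_n}) : enum_ring R g :=
  \sum_(u : {ffun 'I_g -> 'rV['F_2]_n} | [forall k, u k \in C])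
    \prod_(a : 'cV['F_2]_g) 'X_(enum_rank a) ^+ count_col u a.

Inductive subalgebra_gen S : enum_ring R g -> Prop :=
| Gen_in p of S p : subalgebra_gen S p
| Gen_scalar (c : complex R) : subalgebra_gen S c%:MP
| Gen_add p q of subalgebra_gen S p & subalgebra_gen S q :
    subalgebra_gen S (p + q)
| Gen_mul p q of subalgebra_gen S p & subalgebra_gen S q :
    subalgebra_gen S (p * q).

Definition ringB : enum_ring R g -> Prop :=
  subalgebra_gen (fun p => exists n (C : {vspace 'rV['F_2]_n}),
    type_II C /\ p = weight_enum C).

Definition ringD : enum_ring R g -> Prop :=
  subalgebra_gen (fun p => exists n,
    [/\ (0 < n)%N, (8 %| n)%N & p = weight_enum (dplus n)]).

Definition ringA : enum_ring R g -> Prop :=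
  subalgebra_gen (fun p => exists n (C : {vspace 'rV['F_2]_n}),
    [/\ (0 < n)%N, (8 %| n)%N,
        C = dplus n \/ (type_II C /\ neighbors C (dplus n))
      & p = weight_enum C]).

Definition homog_part A (d : nat) : enum_ring R g -> Prop :=
  fun p => A p /\ p \is d.-homog.

(* Homogeneous components of distinct degrees are independent, so their sum
   is automatically direct. *)
Definition upto_degree A (m : nat) : enum_ring R g -> Prop :=
  fun p => exists f : 'I_m.+1 -> enum_ring R g,
    (forall d : 'I_m.+1, homog_part A d (f d)) /\ p = \sum_(d < m.+1) f d.

End Rings.

(* Main.v *)
Require Import Defs.
From HB Require Import structures.
From mathcomp Require Import all_boot all_order all_algebra.
From mathcomp Require Import complex mpoly.
From mathcomp Require Import reals.
From mathcomp Require Import ring zify.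

Set Implicit Arguments.
Unset Strict Implicit.
Unset Printing Implicit Defensive.

Import Order.TTheory GRing.Theory Num.Theory.
Local Open Scope ring_scope.

(** The inclusions of D in A and of A in B come from the generators, once the
    codes d_n^+ are known to be Type II (lemma [type_II_dplus]).  The content
    is that B is contained in D in degrees at most 24, a truncated form of
    Gleason's theorem.

    A genus 1 weight enumerator f(x, y) of a Type II code satisfies
    f(x, i y) = f(x, y), since all weights are divisible by 4, and
    f((x + y) / sqrt 2, (x - y) / sqrt 2) = f(x, y), by the MacWilliams
    identity.  Both conditions are multiplicative, so all of B satisfies them.
    A binary form of degree d that satisfies them is very constrained
    ([gleason_order]): if y^m divides f, then so does the m-th power of each
    linear form obtained from y by the two substitutions, and these are, up to
    scalars, the six forms x, y, x + y, x - y, x + i y and x - i y.  Hence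
    6 m <= d unless f = 0.  As only the powers y^(4j) occur in f, f is
    determined by its coefficient of x^d when d < 24, and by its coefficients
    of x^24 and x^20 y^4 when d = 24 ([gleason_eq0]).  Moreover the coefficient
    of x^d vanishes unless 8 divides d ([gleason_deg_mod8]).

    It remains to produce enough elements of D ([ringB_sub_ringD]).  In degree
    8k the power W^k of the enumerator W of d_8^+ has leading coefficient 1.
    In degree 24 the forms W^3 and W_{d_24^+} both have leading coefficient 1,
    but their coefficients of x^20 y^4 are 42 on one side and, on the other,
    at least the 66 words of weight 4 that are unions of two of the 12 pairs of
    coordinates; so they are linearly independent. *)

(** * Binary forms invariant under Gleason's group *)

Section BinaryForms.

Variable K : numClosedFieldType.
Implicit Types (P : {poly K}) (c : K).

Lemma expi_eq1 k : 'i ^+ k = 1 :> K -> (4 %| k)%N.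
Proof.
have i4 : 'i ^+ 4 = 1 :> K by rewrite (exprM _ 2 2) sqrCi sqrrN expr1n.
have N1 : -1 != 1 :> K by rewrite -subr_eq0 -opprD oppr_eq0 -mulr2n pnatr_eq0.
have i1 : 'i != 1 :> K.
  by apply: contraNneq N1 => i1; rewrite -sqrCi i1 expr1n.
move=> ik1; move: ik1; rewrite {1}(divn_eq k 4) exprD mulnC exprM i4 expr1n mul1r /dvdn.
case: (k %% 4)%N (ltn_pmod k (isT : (0 < 4)%N)) => [|[|[|[|[]]]]] // _.
- by move/eqP; rewrite expr1 (negbTE i1).
- by move/eqP; rewrite sqrCi (negbTE N1).
- move/eqP; rewrite exprS sqrCi mulrN1 eqr_oppLR => /eqP iN1.
  by have /eqP := sqrCi K; rewrite iN1 sqrrN expr1n eq_sym (negbTE N1).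
Qed.

Lemma sqrtC2_neq0 : sqrtC 2 != 0 :> K.
Proof. by rewrite sqrtC_eq0 pnatr_eq0. Qed.

(** The homogenization of P in degree d, evaluated at A and B.  The target
    algebra is arbitrary: with values in the polynomials themselves,
    divisibility of the form becomes divisibility of polynomials. *)
Definition binary_form (S : comAlgType K) d P (A B : S) : S :=
  \sum_(k < d.+1) P`_k *: (A ^+ (d - k) * B ^+ k).

Lemma binary_formZ (S : comAlgType K) d P (A B : S) c :
  binary_form d P (c *: A) (c *: B) = c ^+ d *: binary_form d P A B.
Proof.
rewrite /binary_form scaler_sumr; apply: eq_bigr => k _.
have le_kd : (k <= d)%N by rewrite -ltnS.
by rewrite !exprZn -scalerAl -scalerAr !scalerA -mulrA -exprD subnK // mulrC.
Qed.

Lemma binary_form1E d P c : (size P <= d.+1)%N ->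
  binary_form d P 1 (c *: 'X) = P \Po (c *: 'X).
Proof.
move=> sP; rewrite comp_polyE /binary_form.
rewrite (big_ord_widen _ (fun k : nat => P`_k *: (c *: 'X) ^+ k) sP).
rewrite [RHS]big_mkcond; apply: eq_bigr => k _; rewrite expr1n mul1r.
by case: ltnP => // /(nth_default 0) ->; rewrite scale0r.
Qed.

Lemma binary_form1X d P : (size P <= d.+1)%N -> binary_form d P 1 'X = P.
Proof.
by move=> sP; rewrite -[X in binary_form _ _ _ X]scale1r binary_form1E //
  scale1r comp_polyXr.
Qed.

Lemma binary_formX1 d P k : (size P <= d.+1)%N -> (k <= d)%N ->
  (binary_form d P 'X 1)`_k = P`_(d - k).
Proof.
move=> sP le_kd; rewrite /binary_form (reindex_inj rev_ord_inj) coef_sum /=.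
rewrite (bigD1 (Ordinal (le_kd : (k < d.+1)%N))) //= expr1n mulr1 subSS.
rewrite coefZ coefXn subKn // eqxx mulr1 big1 ?addr0 // => j ne_jk.
rewrite expr1n mulr1 coefZ coefXn subSS subKn -1?ltnS // eq_sym.
by rewrite (negbTE (ne_jk : nat_of_ord j != k)) mulr0.
Qed.

Lemma dvdp_binary_form d m P (A B : {poly K}) :
  (forall k, (k < m)%N -> P`_k = 0) -> B ^+ m %| binary_form d P A B.
Proof.
move=> P_lt0; rewrite /binary_form.
apply: (big_ind (fun p : {poly K} => B ^+ m %| p)) => [|p q|k _].
- exact: dvdp0.
- exact: dvdp_add.
have [/P_lt0 ->|le_mk] := ltnP k m; first by rewrite scale0r dvdp0.
by rewrite -mul_polyC !dvdp_mull // dvdp_exp2l.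
Qed.

(** The second substitution is kept free of the denominator sqrt 2, whose
    d-th power appears on the right by homogeneity. *)
Definition gleason_form d P : Prop :=
  (size P <= d.+1)%N /\ forall A B : {poly K},
    binary_form d P A ('i *: B) = binary_form d P A B /\
    binary_form d P (A + B) (A - B) = sqrtC 2 ^+ d *: binary_form d P A B.

Section GleasonForms.

Variables (d : nat) (P : {poly K}).
Hypothesis gleasonP : gleason_form d P.
Let sP : (size P <= d.+1)%N := gleasonP.1.
Local Notation f := (@binary_form {poly K} d P).

Let f_i A B : f A ('i *: B) = f A B. Proof. exact: (gleasonP.2 A B).1. Qed.
Let f_pm A B : f (A + B) (A - B) = sqrtC 2 ^+ d *: f A B.
Proof. exact: (gleasonP.2 A B).2. Qed.
Let f_N A B : f A (- B) = f A B.
Proof.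
by rewrite -[RHS]f_i -[RHS]f_i scalerA -expr2 sqrCi scaleN1r.
Qed.

Let fX : f 1 'X = P. Proof. exact: binary_form1X. Qed.

(** Exchanging the variables is the sign change of B conjugated by the
    MacWilliams substitution. *)
Lemma gleason_formC A B : f A B = f B A.
Proof.
apply: (scalerI (expf_neq0 d sqrtC2_neq0)).
by rewrite -!f_pm -f_N opprB addrC.
Qed.

Lemma gleason_coefC k : (k <= d)%N -> P`_k = P`_(d - k).
Proof.
by move=> le_kd; rewrite -binary_formX1 // -gleason_formC binary_form1X.
Qed.

Lemma gleason_coef_mod4 k : ~~ (4 %| k)%N -> P`_k = 0.
Proof.
move=> nd4k; have /(congr1 (fun p : {poly K} => p`_k)) := f_i 1 'X.
rewrite binary_form1X // binary_form1E // => Pik.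
have coefPi: (P \Po ('i *: 'X))`_k = 'i ^+ k * P`_k.
  rewrite comp_polyE coef_sum.
  under eq_bigr => j _ do rewrite exprZn scalerA coefZ coefXn.
  have [lt_k|le_k] := ltnP k (size P).
    rewrite (bigD1 (Ordinal lt_k)) //= eqxx mulr1 big1 ?addr0 1?mulrC // => j.
    by rewrite eq_sym -val_eqE /= => /negbTE ->; rewrite mulr0.
  rewrite (nth_default _ le_k) mulr0 big1 // => j _.
  by rewrite gtn_eqF ?mulr0 // (leq_trans (ltn_ord j)).
move: Pik; rewrite coefPi => /eqP.
rewrite -subr_eq0 -[X in _ - X]mul1r -mulrBl mulf_eq0 subr_eq0 => /orP[] /eqP // ik1.
by rewrite (expi_eq1 ik1) in nd4k.
Qed.

Let f10 : f 1 0 = (P`_0)%:P.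
Proof.
rewrite /binary_form big_ord_recl /= expr1n mulr1 alg_polyC big1 ?addr0 //.
by move=> j _; rewrite expr0n mulr0 scaler0.
Qed.

Let f11 : f 1 1 = sqrtC 2 ^+ d *: (P`_0)%:P.
Proof. by rewrite -f10 -f_pm addr0 subr0. Qed.

(** The substitutions generate a scalar matrix of order 8.  Following the point
    (1, 0) through (1, 1), (1, i) and (1 + i, 1 - i), which is 1 + i times
    (1, - i), gives the value of the form in two ways, whence
    (1 + i)^d = (sqrt 2)^d. *)
Lemma gleason_deg_mod8 : P`_0 != 0 -> (8 %| d)%N.
Proof.
move=> P0; set s : K := sqrtC 2.
have f1i : f 1 ('i%:P) = s ^+ d *: (P`_0)%:P.
  by rewrite -f11 -[RHS]f_i alg_polyC.
have fpm : f (1 + 'i%:P) (1 - 'i%:P) = (s ^+ d * s ^+ d) *: (P`_0)%:P.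
  by rewrite f_pm f1i scalerA.
have E1 : (1 + 'i%:P) = (1 + 'i) *: 1 :> {poly K}.
  by rewrite alg_polyC polyCD.
have E2 : (1 - 'i%:P) = (1 + 'i) *: (- 'i%:P) :> {poly K}.
  rewrite -mul_polyC polyCD polyC1 mulrN mulrDl mul1r -polyCM -expr2 sqrCi.
  by rewrite polyCN polyC1 opprD opprK addrC.
have e_d : (1 + 'i) ^+ d = s ^+ d.
  move: fpm; rewrite E1 E2 binary_formZ f_N f1i scalerA -!mul_polyC -!polyCM.
  move=> /polyC_inj/(mulIf P0)/mulIf; apply.
  by rewrite expf_neq0 // sqrtC2_neq0.
(* Squaring the identity gives i^d = 1, hence d = 4 e; since (1 + i)^4 = - 4
   and (sqrt 2)^4 = 4, the identity itself then says that e is even. *)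
have oneDi2 : (1 + 'i) ^+ 2 = 'i * 2 :> K.
  by rewrite sqrrD expr1n mul1r sqrCi addrAC subrr add0r mulr_natr.
have /expi_eq1/dvdnP[e def_d]: 'i ^+ d = 1 :> K.
  apply: (mulIf (expf_neq0 d (negbT (pnatr_eq0 K 2)))).
  by rewrite mul1r -exprMn -oneDi2 -exprM mulnC exprM e_d -exprM mulnC exprM sqrtCK.
have e4: (- 4) ^+ e = 4 ^+ e :> K.
  move: e_d; rewrite def_d ![(e * 4)%N]mulnC !(exprM _ 4) !(exprM _ 2 2).
  by rewrite oneDi2 sqrtCK (exprMn 2 'i 2) sqrCi mulN1r -natrX.
have : (-1) ^+ e = 1 :> K.
  apply: (mulIf (expf_neq0 e (negbT (pnatr_eq0 K 4)))).
  by rewrite mul1r -exprMn mulN1r.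
rewrite -signr_odd def_d; case: (boolP (odd e)) => [_|even_e _]; last first.
  by rewrite (_ : 8 = 2 * 4)%N // dvdn_pmul2r // dvdn2.
rewrite expr1 => /eqP; rewrite -subr_eq0 -opprD oppr_eq0 -mulr2n.
by rewrite pnatr_eq0.
Qed.

(** Dehomogenizing at A = 1, B = 'X: the m-th power of the second argument of
    the form divides it, and the MacWilliams substitution turns that argument
    into 1 - c 'X without changing the form, up to a nonzero scalar. *)
Lemma dvdp_gleason_linear m c : c != 0 -> f 1 (c *: 'X) = P -> 'X^m %| P ->
  (1 - c *: 'X) ^+ m %| P.
Proof.
move=> c0 fc XmP.
have P_lt0 k : (k < m)%N -> P`_k = 0.
  by move=> lt_km; case/dvdpP: XmP => q ->; rewrite coefMXn lt_km.
have := dvdp_binary_form d (1 + c *: 'X) (1 - c *: 'X) P_lt0.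
by rewrite f_pm fc dvdpZr // expf_neq0 // sqrtC2_neq0.
Qed.

(** Divisibility by the m-th powers of the five pairwise coprime factors 'X and
    'X - c, for c a fourth root of unity, needs degree 5 m; the factor of the
    sixth linear form, at infinity, lowers the degree by m, because the
    coefficients are symmetric ([gleason_coefC]). *)
Lemma gleason_order m : P != 0 -> 'X^m %| P -> (6 * m <= d)%N.
Proof.
move=> P0 XmP.
have roots_dvd (c : K) : c \in [:: 0; 1; -1; 'i; - 'i] ->
    ('X - c%:P) ^+ m %| P.
  have lin (b : K) : b * c = 1 -> f 1 (b *: 'X) = P -> ('X - c%:P) ^+ m %| P.
    move=> bc1 fb.
    have b0 : b != 0 by apply: contra_eq_neq bc1 => ->; rewrite mul0r eq_sym oner_eq0.
    have := dvdp_gleason_linear b0 fb XmP.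
    have -> : 1 - b *: 'X = (- b) *: ('X - c%:P).
      by rewrite scalerBr !scaleNr opprK addrC -[_ *: c%:P]mul_polyC -polyCM bc1.
    by rewrite exprZn dvdpZl // expf_neq0 // oppr_eq0.
  have i2 : 'i * 'i = -1 :> K by rewrite -expr2 sqrCi.
  rewrite !inE => /or4P[/eqP -> | /eqP c1 | /eqP cN1 | /orP[] /eqP ci].
  - by rewrite subr0.
  - by apply: (lin 1); rewrite ?c1 ?mulr1 ?scale1r.
  - by apply: (lin (-1)); rewrite ?cN1 ?mulrNN ?mulr1 // scaleN1r f_N.
  - by apply: (lin (- 'i)); rewrite ?ci ?mulNr ?i2 ?opprK // scaleNr f_N f_i.
  - by apply: (lin 'i); rewrite ?ci ?mulrN ?i2 ?opprK // f_i.
have prod_dvd (s : seq K) : uniq s -> {in s, forall c, ('X - c%:P) ^+ m %| P} ->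
    \prod_(c <- s) ('X - c%:P) ^+ m %| P.
  elim: s => [|c s IHs] /=; first by rewrite big_nil dvd1p.
  case/andP=> cNs uniq_s dvdP; rewrite big_cons Gauss_dvdp; last first.
    rewrite big_seq; elim/big_ind: _ => [|p q|a a_s].
    - exact: coprimep1.
    - by rewrite coprimepMr => -> ->.
    rewrite coprimep_expl // coprimep_expr // coprimep_XsubC root_XsubC.
    by apply: contraNneq cNs => <-.
  rewrite dvdP ?mem_head // IHs // => a a_s.
  by apply: dvdP; rewrite inE a_s orbT.
have N1 : 1 != -1 :> K by rewrite -subr_eq0 opprK -mulr2n pnatr_eq0.
have sq_i (c : K) : c ^+ 2 = 1 -> (c != 'i) && (c != - 'i).
  move=> c2; rewrite -negb_or -eqf_sqr c2 sqrCi; exact: N1.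
have uniq5 : uniq [:: 0; 1; -1; 'i; - 'i : K].
  rewrite /= !inE !negb_or ![0 == _]eq_sym oner_eq0 !oppr_eq0 oner_eq0 neq0Ci.
  rewrite N1 !sq_i ?sqrrN ?expr1n //= andbT eq_sym -subr_eq0 -opprD oppr_eq0.
  by rewrite -mulr2n mulrn_eq0 neq0Ci.
have := dvdp_leq P0 (prod_dvd _ uniq5 roots_dvd).
have -> : size (\prod_(c <- [:: 0; 1; -1; 'i; - 'i : K]) ('X - c%:P) ^+ m)
    = (5 * m).+1.
  rewrite size_prod_seq => [|c _]; last by rewrite expf_neq0 // polyXsubC_eq0.
  by under eq_bigr => c _ do rewrite size_exp_XsubC; rewrite !big_cons big_nil /=; lia.
have sPm : (size P <= d.+1 - m)%N.
  apply/leq_sizeP => k le_k; have [lt_dk|le_kd] := ltnP d k.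
    by rewrite nth_default // (leq_trans sP).
  rewrite gleason_coefC //; case/dvdpP: XmP => q ->.
  by rewrite coefMXn (_ : (d - k < m)%N) //; lia.
move=> /leq_trans/(_ sPm); lia.
Qed.

(** Only every fourth coefficient can be nonzero, so each further coefficient
    that vanishes raises the order m of [gleason_order] by 4: up to m = 4,
    which needs degree 24, and m = 8, which needs degree 48. *)
Lemma gleason_eq0 : P`_0 = 0 -> (d < 24)%N \/ d = 24 /\ P`_4 = 0 -> P = 0.
Proof.
move=> P0 dP; apply/eqP; apply: contraT => nzP.
have XP m : (forall k, (k < m)%N -> P`_k = 0) -> 'X^m %| P.
  by move=> P_lt0; rewrite -fX; apply: dvdp_binary_form.
have [lt_d24 | [d24 P4]] := dP.
  have /(gleason_order nzP) : 'X^4 %| P; last by lia.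
  by apply: XP => -[|[|[|[|]]]] // _; rewrite gleason_coef_mod4.
have /(gleason_order nzP) : 'X^8 %| P; last by lia.
by apply: XP => -[|[|[|[|[|[|[|[|]]]]]]]] // _; rewrite gleason_coef_mod4.
Qed.

(** The MacWilliams substitution takes (1, 0), where the form has value P`_0, to
    (1, 1), where it is the sum of the coefficients. *)
Lemma gleason_coef_sum : \sum_(k < d.+1) P`_k = sqrtC 2 ^+ d * P`_0.
Proof.
have /(congr1 (fun p : {poly K} => p`_0)) := f11.
rewrite coefZ coefC eqxx => <-; rewrite /binary_form coef_sum.
by apply: eq_bigr => k _; rewrite !expr1n mulr1 coefZ coef1 mulr1.
Qed.

End GleasonForms.

(** The coefficients are symmetric with sum (sqrt 2)^8 = 16, which leaves
    14 for the middle one: invariance alone gives the enumerator of d_8^+. *)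
Lemma gleason_form8 P : gleason_form 8 P -> P`_0 = 1 ->
  P = 1 + 'X^4 * (14%:P + 'X^4).
Proof.
move=> G P0; have P8 : P`_8 = 1 by rewrite (gleason_coefC G).
have Pmod4 := gleason_coef_mod4 G.
have P4 : P`_4 = 14.
  have := gleason_coef_sum G; rewrite !big_ord_recr big_ord0 /= P0 P8.
  rewrite (Pmod4 1%N) // (Pmod4 2%N) // (Pmod4 3%N) // (Pmod4 5%N) //.
  rewrite (Pmod4 6%N) // (Pmod4 7%N) // !addr0 add0r mulr1.
  rewrite (exprM _ 2 4) sqrtCK => /(canRL (addrK _)) => e.
  by apply: (addrI 1); rewrite e -natrX; ring.
apply/polyP => k; rewrite coefD coef1 coefXnM coefD coefC coefXn.
have [lt_k | le_k] := ltnP k 4.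
  by rewrite addr0; case: k lt_k => [|k] lt_k; rewrite // Pmod4 // /dvdn modn_small.
have [-> | ne4] := eqVneq k 4%N; first by rewrite /= P4 add0r addr0.
have [-> | ne8] := eqVneq k 8%N; first by rewrite /= P8 !add0r.
have [-> -> ->] : [/\ (k == 0)%N = false, (k - 4 == 0)%N = false & (k - 4 == 4)%N = false].
  by split; lia.
rewrite !addr0; have [lt8k | le_k8] := ltnP 8 k.
  by rewrite nth_default // (leq_trans G.1).
by rewrite Pmod4 //; lia.
Qed.

Lemma gleason_form8_cube P : gleason_form 8 P -> P`_0 = 1 -> (P ^+ 3)`_4 = 42.
Proof.
move=> G P0; rewrite (gleason_form8 G P0); set q : {poly K} := 14%:P + 'X^4.
have -> : (1 + 'X^4 * q) ^+ 3 =
    1 + 'X^4 * (q *+ 3) + 'X^4 * ('X^4 * (q ^+ 2 *+ 3 + 'X^4 * q ^+ 3)) by ring.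
rewrite !coefD coef1 !coefXnM /= add0r addr0 coefMn coefD coefXn coefC addr0.
by rewrite -mulrnA.
Qed.

End BinaryForms.

(** * Binary codes and the MacWilliams identity *)

Lemma F2P (x : 'F_2) : x = 0 \/ x = 1.
Proof. by case: x => [[|[|//]] ltx]; [left | right]; apply: val_inj. Qed.

Lemma F2_addxx (x : 'F_2) : x + x = 0.
Proof. by case: (F2P x) => ->; apply: val_inj. Qed.

Section Codes.
Variable n : nat.
Implicit Types (u v w : 'rV['F_2]_n) (C : {vspace 'rV['F_2]_n}).

Lemma dotpC u v : dotp u v = dotp v u.
Proof. by apply: eq_bigr => i _; rewrite mulrC. Qed.

Lemma dotpDr u v w : dotp u (v + w) = dotp u v + dotp u w.
Proof. by rewrite -big_split; apply: eq_bigr => i _; rewrite mxE mulrDr. Qed.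

Lemma dotpZr c u v : dotp u (c *: v) = c * dotp u v.
Proof. by rewrite mulr_sumr; apply: eq_bigr => i _; rewrite mxE mulrCA. Qed.

Lemma mem_dual C u : reflect (forall v, v \in C -> dotp u v = 0) (u \in dual_code C).
Proof.
rewrite inE; apply: (iffP forallP) => [orth v Cv | orth v].
  by apply/eqP/(implyP (orth v)).
by apply/implyP => /orth ->.
Qed.

Lemma wtE u : wt u = (\sum_(i < n) (u 0%R i != 0%R))%N.
Proof.
by rewrite /wt -sum1dep_card big_mkcond; apply: eq_bigr => i _; case: (u 0 i != 0).
Qed.

(** The two weights count twice the common support, whose size has the parity
    of the inner product. *)
Lemma wtD_mod4 u v : (4 %| wt u)%N -> (4 %| wt v)%N -> dotp u v = 0 ->
  (4 %| wt (u + v))%N.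
Proof.
pose k := (\sum_(i < n) ((u 0%R i != 0%R) && (v 0%R i != 0%R)))%N.
have wt_add : (wt (u + v) + 2 * k = wt u + wt v)%N.
  rewrite !wtE big_distrr -!big_split; apply: eq_bigr => i _; rewrite mxE.
  by case: (F2P (u 0 i)) (F2P (v 0 i)) => -> [] ->.
have -> : dotp u v = k%:R.
  rewrite natr_sum; apply: eq_bigr => i _.
  by case: (F2P (u 0 i)) (F2P (v 0 i)) => -> [] ->; apply: val_inj.
move=> u4 v4 /eqP; rewrite -(dvdn_pcharf (pchar_Fp (isT : prime 2))) => k2.
have : (4 %| wt (u + v) + 2 * k)%N by rewrite wt_add dvdn_add.
by rewrite dvdn_addl // (@dvdn_pmul2l 2 2).
Qed.

Lemma span_orthogonal (X : seq 'rV['F_2]_n) u :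
  {in X, forall x, dotp u x = 0} -> forall v, v \in <<X>>%VS -> dotp u v = 0.
Proof.
elim: X => [|x X IHX] orth v.
  rewrite span_nil memv0 => /eqP ->; rewrite -(scale0r 0) dotpZr mul0r //.
rewrite span_cons => /memv_addP[_ /vlineP[c ->] [w Xw ->]].
rewrite dotpDr dotpZr orth ?mem_head // mulr0 add0r IHX // => y Xy.
by apply: orth; rewrite inE Xy orbT.
Qed.

Lemma span_doubly_even (X : seq 'rV['F_2]_n) :
  {in X &, forall x y, dotp x y = 0} -> {in X, forall x, (4 %| wt x)%N} ->
  forall v, v \in <<X>>%VS -> (4 %| wt v)%N.
Proof.
elim: X => [|x X IHX] orth X4 v.
  rewrite span_nil memv0 => /eqP ->.
  by rewrite wtE big1 // => i _; rewrite mxE.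
rewrite span_cons => /memv_addP[_ /vlineP[c ->] [w Xw ->]].
have subX y : y \in X -> y \in x :: X by rewrite inE orbC => ->.
have w4 : (4 %| wt w)%N.
  by apply: IHX Xw => [y z yX zX | y yX]; [apply: orth | apply: X4]; apply: subX.
case: (F2P c) => ->; first by rewrite scale0r add0r.
rewrite scale1r; apply: wtD_mod4 w4 _; first by rewrite X4 ?mem_head.
by apply: (span_orthogonal _ Xw) => y yX; apply: orth; rewrite ?mem_head ?subX.
Qed.

(** Orthogonality and divisibility by 4 pass from the generators to the span;
    for self-duality one inclusion is then left. *)
Lemma type_II_span (X : seq 'rV['F_2]_n) :
  {in X &, forall x y, dotp x y = 0} -> {in X, forall x, (4 %| wt x)%N} ->
  (forall u, {in X, forall x, dotp u x = 0} -> u \in <<X>>%VS) ->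
  type_II <<X>>%VS.
Proof.
move=> orth X4 dual_sub; split; last exact: span_doubly_even.
apply/setP=> u; rewrite inE; apply/idP/mem_dual => [Xu v Xv | u_orth].
  apply: span_orthogonal Xv => x Xx; rewrite dotpC.
  by apply: span_orthogonal Xu => y Xy; apply: orth.
by apply: dual_sub => x Xx; apply/u_orth/memv_span.
Qed.

(** The genus 1 weight enumerator, evaluated at A and B. *)
Definition code_enum (S : comNzRingType) C (A B : S) : S :=
  \sum_(u | u \in C) \prod_(i < n) (if u 0 i == 0 then A else B).

(** The nontrivial additive character of the field with two elements. *)
Definition sgnF2 (x : 'F_2) : int := if x == 0 then 1 else -1.

Lemma sgnF2D x y : sgnF2 (x + y) = sgnF2 x * sgnF2 y.
Proof. by case: (F2P x) (F2P y) => -> [] ->. Qed.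

Lemma sgnF2_sum (I : Type) (r : seq I) (F : I -> 'F_2) :
  sgnF2 (\sum_(i <- r) F i) = \prod_(i <- r) sgnF2 (F i).
Proof. by elim/big_rec2: _ => // i y _ _ <-; rewrite sgnF2D. Qed.

(** The Fourier transform on words factors over the coordinates. *)
Lemma hadamard_prod (S : comNzRingType) (A B : S) u :
  \prod_(i < n) (if u 0 i == 0 then A + B else A - B) =
  \sum_(v : 'rV['F_2]_n) (sgnF2 (dotp u v))%:~R *
     \prod_(i < n) (if v 0 i == 0 then A else B).
Proof.
transitivity (\prod_(i < n) \sum_(t : 'F_2)
   (sgnF2 (u 0 i * t))%:~R * (if t == 0 then A else B)).
  apply: eq_bigr => i _; rewrite big_ord_recl big_ord1 /=.
  by case: (F2P (u 0 i)) => -> /=; rewrite ?mul1r // mulN1r.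
rewrite bigA_distr_bigA /=.
rewrite (reindex (fun v : 'rV['F_2]_n => [ffun i => v 0 i])) /=; last first.
  exists (fun g : {ffun 'I_n -> 'F_2} => \row_i g i) => [v _ | g _].
    by apply/rowP=> i; rewrite mxE ffunE.
  by apply/ffunP=> i; rewrite ffunE mxE.
apply: eq_bigr => v _; rewrite sgnF2_sum rmorph_prod -big_split /=.
by apply: eq_bigr => i _; rewrite ffunE.
Qed.

(** Orthogonality of characters: translating by a codeword w with
    dotp w v = 1 changes the sign of the sum. *)
Lemma sgnF2_code_sum C v :
  \sum_(u | u \in C) sgnF2 (dotp u v) = if v \in dual_code C then #|C|%:R else 0.
Proof.
case: mem_dual => [orth | not_orth].
  rewrite -sum1_card natr_sum big_mkcond [RHS]big_mkcond.
  by apply: eq_bigr => u _; case: ifP => // Cu; rewrite dotpC orth.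
have [w Cw wv] : exists2 w, w \in C & dotp w v = 1.
  have /existsP[w /andP[Cw wv]] : [exists w, (w \in C) && (dotp w v != 0)].
    apply: contra_notT not_orth => /existsPn no_w w Cw; apply/eqP.
    by have := no_w w; rewrite Cw dotpC => /negPn.
  by exists w => //; case: (F2P (dotp w v)) wv => ->.
set s := (X in X = _); suff : s = - s by lia.
rewrite {1}/s (reindex_inj (addrI w)) /= -sumrN.
apply: eq_big => [u | u _]; first by rewrite rpredDl.
by rewrite dotpC dotpDr sgnF2D ![dotp v _]dotpC wv mulN1r.
Qed.

Lemma macwilliams (S : comNzRingType) C (A B : S) : self_dual C ->
  code_enum C (A + B) (A - B) = #|C|%:R * code_enum C A B.
Proof.
move=> sdC; rewrite /code_enum; under eq_bigr => u _ do rewrite hadamard_prod.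
rewrite exchange_big big_mkcond mulr_sumr [RHS]big_mkcond; apply: eq_bigr => v _ /=.
rewrite -mulr_suml -rmorph_sum sgnF2_code_sum -sdC inE; case: ifP => _.
  by rewrite rmorph_nat.
by rewrite rmorph0 mul0r.
Qed.

(** The MacWilliams identity at A = B = 1 compares the whole space with the
    code, because only the zero word contributes when the second argument
    is 0. *)
Lemma card_self_dual C : self_dual C -> (#|C| ^ 2 = 2 ^ n)%N.
Proof.
move=> sdC; have := macwilliams (1 : int) 1 sdC.
have -> : code_enum C (1 : int) 1 = #|C|%:R.
  rewrite /code_enum -sum1_card natr_sum; apply: eq_bigr => u _.
  by rewrite big1 // => i _; case: ifP.
rewrite subrr /code_enum (bigD1 0) ?mem0v //= [X in _ + X]big1 ?addr0 => [|u /andP[_ u0]].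
  under eq_bigr => i _ do rewrite mxE eqxx.
  rewrite prodr_const card_ord => /eqP.
  by rewrite -mulr2n -natrX -natrM eqr_nat mulnn => /eqP <-.
have [i ui] : exists i, u 0 i != 0.
  apply/existsP; apply: contraNT u0 => /existsPn u0; apply/eqP/rowP => i.
  by rewrite mxE; apply/eqP/negPn/u0.
by rewrite (bigD1 i) //= (negbTE ui) mul0r.
Qed.

Lemma prod_wt (S : comNzRingType) (A B : S) u :
  \prod_(i < n) (if u 0 i == 0 then A else B) = A ^+ (n - wt u) * B ^+ wt u.
Proof.
have wtn : wt u = #|[pred i | u 0 i != 0]| by rewrite /wt cardsE.
have -> : (n - wt u)%N = #|[pred i | u 0 i == 0]|.
  rewrite wtn -{1}(card_ord n) -(cardC [pred i | u 0 i != 0]) addKn.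
  by apply: eq_card => i; rewrite !inE negbK.
rewrite wtn (bigID (fun i => u 0 i == 0)) /=; congr (_ * _).
  by rewrite -prodr_const; apply: eq_bigr => i ->.
by rewrite -prodr_const; apply: eq_bigr => i /negbTE ->.
Qed.

End Codes.

(** * The codes d_n^+ *)

Section Dplus.

Lemma sum_pairs (V : nmodType) n (F : nat -> V) : ~~ odd n ->
  \sum_(j < n) F j = \sum_(k < n./2) (F k.*2 + F k.*2.+1).
Proof.
move=> even_n; rewrite -[in LHS](even_halfK even_n).
elim: n./2 => [|m IHm]; first by rewrite !big_ord0.
by rewrite doubleS !big_ord_recr /= IHm addrA.
Qed.

Variable n : nat.
Implicit Types (u v : 'rV['F_2]_n) (f : nat -> 'F_2).

(** The words of d_n^+ other than those of the glue coset are constant on the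
    pairs {2 k, 2 k + 1} of coordinates, numbered here from 0; [doubled f] is
    the word with value f k on the k-th pair. *)
Definition doubled f : 'rV['F_2]_n := \row_j f j./2.

(** Indexing by natural numbers, with value 0 out of range, lets the
    coordinates 2 k and 2 k + 1 be named without bound proofs. *)
Definition coord_nat u (k : nat) : 'F_2 := oapp (u 0) 0 (insub k).

Lemma coord_natE u (j : 'I_n) : coord_nat u j = u 0 j.
Proof. by rewrite /coord_nat valK. Qed.

Lemma dplus_rowE k : (0 < k)%N ->
  dplus_row n k.+1 = doubled (fun l => (l == 0%N)%:R + (l == k)%:R).
Proof.
move=> k0; apply/rowP=> j; rewrite !mxE !inE.
have -> : [|| j.+1 == 1, j.+1 == 2, j.+1 == (2 * k.+1).-1 | j.+1 == 2 * k.+1]%N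
   = (j./2 == 0)%N || (j./2 == k) by lia.
have [-> | _] := eqVneq j./2 0%N; last by rewrite add0r.
by rewrite eq_sym gtn_eqF // addr0.
Qed.

Hypothesis even_n : ~~ odd n.

Lemma ltn_half2 k : (k < n./2)%N -> (k.*2.+1 < n)%N.
Proof. lia. Qed.

Lemma dotp_pairs u v :
  dotp u v = \sum_(k < n./2) (coord_nat u k.*2 * coord_nat v k.*2 +
                              coord_nat u k.*2.+1 * coord_nat v k.*2.+1).
Proof.
rewrite -(sum_pairs (fun j => coord_nat u j * coord_nat v j)) //.
by apply: eq_bigr => j _; rewrite !coord_natE.
Qed.

Lemma wt_pairs u :
  wt u = (\sum_(k < n./2) ((coord_nat u k.*2 != 0%R) + (coord_nat u k.*2.+1 != 0%R)))%N.
Proof.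
rewrite -(sum_pairs (fun j => (coord_nat u j != 0) : nat)) //.
by rewrite wtE; apply: eq_bigr => j _; rewrite coord_natE.
Qed.

Lemma coord_nat_row (F : nat -> 'F_2) k : (k < n)%N -> coord_nat (\row_j F j) k = F k.
Proof. by move=> lt_k; rewrite -[k]/(val (Ordinal lt_k)) coord_natE mxE. Qed.

Lemma coord_nat_doubled f k : (k < n./2)%N ->
  coord_nat (doubled f) k.*2 = f k /\ coord_nat (doubled f) k.*2.+1 = f k.
Proof.
move=> lt_k; have := ltn_half2 lt_k => lt2k.
rewrite !(coord_nat_row (fun j => f j./2)) ?(ltnW lt2k) //.
by rewrite doubleK -[k.*2.+1]/(true + k.*2)%N half_bit_double.
Qed.

Lemma coord_nat_glue k : (k < n./2)%N ->
  coord_nat (dplus_glue n) k.*2 = 1 /\ coord_nat (dplus_glue n) k.*2.+1 = 0.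
Proof.
move=> lt_k; have := ltn_half2 lt_k => lt2k.
rewrite !(coord_nat_row (fun j => (odd j.+1)%:R)) ?(ltnW lt2k) //=.
by rewrite odd_double.
Qed.

Lemma dotp_doubled u f :
  dotp u (doubled f) = \sum_(k < n./2) (coord_nat u k.*2 + coord_nat u k.*2.+1) * f k.
Proof.
rewrite dotp_pairs; apply: eq_bigr => k _.
by have [-> ->] := coord_nat_doubled f (ltn_ord k); rewrite mulrDl.
Qed.

Lemma dotp_doubled2 f g : dotp (doubled f) (doubled g) = 0.
Proof.
rewrite dotp_doubled big1 // => k _.
by have [-> ->] := coord_nat_doubled f (ltn_ord k); rewrite F2_addxx mul0r.
Qed.

Lemma dotp_glue u : dotp u (dplus_glue n) = \sum_(k < n./2) coord_nat u k.*2.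
Proof.
rewrite dotp_pairs; apply: eq_bigr => k _.
by have [-> ->] := coord_nat_glue (ltn_ord k); rewrite mulr1 mulr0 addr0.
Qed.

Lemma dotp_doubled_glue f :
  dotp (doubled f) (dplus_glue n) = \sum_(k < n./2) f k.
Proof.
rewrite dotp_glue; apply: eq_bigr => k _.
by have [-> _] := coord_nat_doubled f (ltn_ord k).
Qed.

Lemma wt_doubled f : wt (doubled f) = (2 * #|[set k : 'I_n./2 | f k != 0%R]|)%N.
Proof.
rewrite wt_pairs -sum1dep_card big_distrr /= [RHS]big_mkcond.
apply: eq_bigr => k _; have [-> ->] := coord_nat_doubled f (ltn_ord k).
by case: (f k != 0).
Qed.

Lemma wt_glue : wt (dplus_glue n) = n./2.
Proof.
rewrite wt_pairs -[RHS]card_ord -sum1_card; apply: eq_bigr => k _.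
by have [-> ->] := coord_nat_glue (ltn_ord k).
Qed.

Lemma mem_dplus_row k : (0 < k < n./2)%N -> dplus_row n k.+1 \in dplus n.
Proof.
move=> lt_k; apply: memv_span; rewrite inE; apply/orP; right.
by apply: map_f; rewrite mem_index_iota.
Qed.

(** In characteristic 2 the condition on the sum of f lets the word of the
    pair 0 be added to every pair word, which turns the decomposition of
    [doubled f] along the pairs into one along the rows of the generator
    matrix; the term for the pair 0 then vanishes. *)
Lemma mem_doubled f : \sum_(k < n./2) f k = 0 -> doubled f \in dplus n.
Proof.
move=> f0.
have -> : doubled f = \sum_(k < n./2)
    f k *: doubled (fun l => (l == 0%N)%:R + (l == k)%:R).
  apply/rowP=> j; rewrite summxE mxE.
  under eq_bigr => k _ do rewrite !mxE mulrDr.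
  rewrite big_split /= -mulr_suml f0 mul0r add0r.
  have lt_j : (j./2 < n./2)%N by move: (ltn_ord j); lia.
  rewrite (bigD1 (Ordinal lt_j)) //= eqxx mulr1 big1 ?addr0 // => k.
  by rewrite -val_eqE /= eq_sym => /negbTE ->; rewrite mulr0.
apply: memv_suml => k _; apply: memvZ.
have [k0 | k0] := posnP k; last by rewrite -dplus_rowE // mem_dplus_row // k0 /=.
rewrite k0 (_ : doubled _ = 0) ?mem0v //.
by apply/rowP=> j; rewrite !mxE F2_addxx.
Qed.

(** A word u orthogonal to the rows has the same sum c on all pairs, so that
    u + c * glue is constant on the pairs; orthogonality to the glue word then
    gives the condition of [mem_doubled]. *)
Lemma type_II_dplus : (8 %| n)%N -> type_II (dplus n).
Proof.
move=> n8; have m4 : (4 %| n./2)%N by lia.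
have row_sum k : (0 < k < n./2)%N ->
    \sum_(l < n./2) ((l == 0%N :> nat)%:R + (l == k :> nat)%:R) = 0 :> 'F_2.
  move=> /andP[k0 lt_k]; rewrite big_split /=.
  have one l : (l < n./2)%N -> \sum_(i < n./2) (i == l :> nat)%:R = 1 :> 'F_2.
    move=> lt_l; rewrite (bigD1 (Ordinal lt_l)) //= eqxx big1 ?addr0 // => i.
    by rewrite -val_eqE /= => /negbTE ->.
  by rewrite !one ?F2_addxx // (leq_trans _ lt_k).
have gensP x : x \in dplus_glue n :: [seq dplus_row n i | i <- index_iota 2 n./2.+1] ->
    x = dplus_glue n \/ exists2 k, (0 < k < n./2)%N &
      x = doubled (fun l => (l == 0%N)%:R + (l == k)%:R).
  rewrite inE => /predU1P[-> | /mapP[[|k]]]; [by left | by rewrite mem_index_iota |].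
  rewrite mem_index_iota => lt_k ->; right; exists k; first by lia.
  by rewrite dplus_rowE //; lia.
have glue_glue : dotp (dplus_glue n) (dplus_glue n) = 0.
  rewrite dotp_glue; under eq_bigr => k _ do rewrite (coord_nat_glue (ltn_ord k)).1.
  rewrite sumr_const card_ord; apply/eqP.
  by rewrite -(dvdn_pcharf (pchar_Fp (isT : prime 2))); lia.
apply: type_II_span => [x y | x | u].
- move=> /gensP[-> | [k lt_k ->]] /gensP[-> | [l lt_l ->]] //.
  + by rewrite dotpC dotp_doubled_glue row_sum.
  + by rewrite dotp_doubled_glue row_sum.
  by rewrite dotp_doubled2.
- case/gensP => [-> | [k /andP[k0 lt_k] ->]]; first by rewrite wt_glue.
  have lt0 := leq_trans (ltn0Sn k) lt_k.
  rewrite wt_doubled (_ : [set _ | _] = [set Ordinal lt0; Ordinal lt_k]).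
    by rewrite cards2 -val_eqE /= ltn_eqF.
  apply/setP=> l; rewrite !inE -[l == Ordinal lt0]val_eqE -[l == Ordinal lt_k]val_eqE /=.
  have [-> | _] := eqVneq (val l) 0%N; first by rewrite (ltn_eqF k0).
  by case: (l == k :> nat).
move=> orth; set U := coord_nat u.
pose c := U 0%N + U 1%N.
have pair_sum k : (k < n./2)%N -> U k.*2 = c + U k.*2.+1.
  move=> lt_k; have [-> | k0] := posnP k.
    by rewrite -addrA F2_addxx addr0.
  have /orth : dplus_row n k.+1 \in
      dplus_glue n :: [seq dplus_row n i | i <- index_iota 2 n./2.+1].
    by rewrite inE map_f ?orbT // mem_index_iota; lia.
  have lt0 := leq_trans (ltn0Sn k) lt_k.
  rewrite dplus_rowE // dotp_doubled (bigD1 (Ordinal lt0)) //=.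
  rewrite (bigD1 (Ordinal lt_k)) //=; last by rewrite -val_eqE /= gtn_eqF.
  rewrite big1 => [|l]; last first.
    by rewrite -!val_eqE /= => /andP[/negbTE -> /negbTE ->]; rewrite addr0 mulr0.
  rewrite (ltn_eqF k0) (gtn_eqF k0) (eqxx k) /= !addr0 add0r !mulr1 -/U -/c.
  move: c (U k.*2) (U k.*2.+1) => x y z.
  move=> /eqP e; apply/eqP; move: e.
  by case: (F2P x) (F2P y) (F2P z) => -> [] -> [] ->.
have defu : u = c *: dplus_glue n + doubled (fun k => U k.*2.+1).
  apply/rowP=> j; rewrite !mxE -coord_natE -/U.
  have lt_j : (j./2 < n./2)%N by move: (ltn_ord j); lia.
  rewrite -[in LHS](odd_double_half j) /=.
  case: (odd j); first by rewrite mulr0 add0r.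
  by rewrite mulr1 pair_sum.
rewrite [u in u \in _]defu; apply: memvD.
  by apply/memvZ/memv_span/mem_head.
apply: mem_doubled; have := orth _ (mem_head _ _).
rewrite dotp_glue -/U (eq_bigr _ (fun k _ => pair_sum _ (ltn_ord k))) big_split /=.
rewrite sumr_const card_ord.
have /eqP -> : c *+ n./2 == 0.
  by rewrite -mulr_natr mulf_eq0 -(dvdn_pcharf (pchar_Fp (isT : prime 2))); lia.
by rewrite add0r.
Qed.

(** The words supported on two of the n / 2 pairs already provide this many
    elements. *)
Lemma card_dplus_wt4 : ('C(n./2, 2) <= #|[set u in dplus n | wt u == 4]|)%N.
Proof.
pose pair_word (S : {set 'I_n./2}) :=
  doubled (fun k => oapp (fun i => (i \in S)%:R) 0 (insub k : option 'I_n./2)).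
have pair_wordE S (k : 'I_n./2) :
    oapp (fun i => (i \in S)%:R) 0 (insub (val k) : option 'I_n./2) = (k \in S)%:R :> 'F_2.
  by rewrite valK.
have pair_word_inj : injective pair_word.
  move=> S T eqST; apply/setP=> k.
  have := (coord_nat_doubled
    (fun k => oapp (fun i => (i \in S)%:R) 0 (insub k : option 'I_n./2))
    (ltn_ord k)).1.
  rewrite -/(pair_word S) eqST (coord_nat_doubled _ (ltn_ord k)).1 !pair_wordE.
  by case: (k \in S) (k \in T) => [] [] // /(congr1 val).
rewrite -[n./2]card_ord -(card_draws _ 2) -(card_imset _ pair_word_inj).
apply/subset_leq_card/subsetP=> x /imsetP[S]; rewrite inE => /eqP S2 ->.
rewrite inE mem_doubled /=; last first.
  under eq_bigr => k _ do rewrite pair_wordE.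
  rewrite -natr_sum -big_mkcond sum1_card S2; exact: val_inj.
rewrite wt_doubled (_ : [set _ | _] = S) ?S2 //.
by apply/setP=> k; rewrite inE pair_wordE; case: (k \in S).
Qed.

End Dplus.

(** * Weight enumerators in genus 1 *)

(** The variable x_a has index [enum_rank a], so the order of the two variables
    inside the index type is never known; this lemma makes it irrelevant. *)
Lemma big_genus1 (T : Type) (idx : T) (op : Monoid.com_law idx)
    (F : 'I_#|{: 'cV['F_2]_1}| -> T) :
  \big[op/idx]_i F i =
    op (F (enum_rank (const_mx 0))) (F (enum_rank (const_mx 1))).
Proof.
rewrite (reindex (fun t : 'F_2 => enum_rank (const_mx t : 'cV_1))) /=; last first.
  exists (fun i => (enum_val i : 'cV['F_2]_1) 0 0) => [t _ | i _].
    by rewrite enum_rankK mxE.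
  rewrite -[RHS]enum_valK; congr enum_rank; apply/colP => j.
  by rewrite mxE ord1.
rewrite big_ord_recl big_ord1.
by congr (op (F _) (F _)); congr enum_rank; congr const_mx; apply: val_inj.
Qed.

Lemma subalgebra_gen_mono (R : realType) g (S T : enum_ring R g -> Prop) p :
  (forall q, S q -> T q) -> subalgebra_gen S p -> subalgebra_gen T p.
Proof.
move=> ST; elim=> [q /ST | c | q r _ ? _ ? | q r _ ? _ ?].
- exact: Gen_in.
- exact: Gen_scalar.
- exact: Gen_add.
exact: Gen_mul.
Qed.

Lemma subalgebra_genX (R : realType) g (S : enum_ring R g -> Prop) p k :
  subalgebra_gen S p -> subalgebra_gen S (p ^+ k).
Proof.
move=> Sp; elim: k => [|k IHk]; first by rewrite expr0; apply: Gen_scalar.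
by rewrite exprS; apply: Gen_mul.
Qed.

Section Evaluation.
Variable R : realType.
Local Notation K := (complex R).
Local Notation ring1 := (enum_ring R 1).

Section EvalAlg.
Variables (S : comAlgType K) (A B : S).

(** The substitution x_0 := A, x_1 := B. *)
Definition genus1_eval : ring1 -> S :=
  mmap (in_alg S) (fun i => if enum_val i == 0 then A else B).
HB.instance Definition _ := GRing.RMorphism.on genus1_eval.

Lemma genus1_evalC c : genus1_eval c%:MP = c%:A.
Proof. exact: mmapC. Qed.

Lemma genus1_evalZ c p : genus1_eval (c%:MP * p) = c *: genus1_eval p.
Proof. by rewrite rmorphM /= genus1_evalC mulr_algl. Qed.

Lemma genus1_evalX t :
  genus1_eval 'X_(enum_rank (const_mx t)) = if t == 0 then A else B.
Proof.
rewrite /genus1_eval mmapX mmap1U enum_rankK.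
have [-> | t0] := eqVneq t 0; first by rewrite eqxx.
by rewrite ifN //; apply: contra_neq t0 => /colP/(_ 0); rewrite !mxE.
Qed.

End EvalAlg.

(** Grouping the coordinates by value recovers the exponents; the ungrouped
    product is a monomial of degree n by inspection and is easy to evaluate. *)
Lemma weight_enum1 n (C : {vspace 'rV['F_2]_n}) :
  weight_enum R 1 C =
    \sum_(u | u \in C) \prod_(i < n) 'X_(enum_rank (const_mx (u 0 i))).
Proof.
rewrite /weight_enum (reindex (fun v : 'rV['F_2]_n => [ffun=> v])) /=; last first.
  exists (fun u : {ffun 'I_1 -> 'rV['F_2]_n} => u 0) => [v _ | u _].
    by rewrite ffunE.
  by apply/ffunP => k; rewrite ffunE ord1.
apply: eq_big => [u | u _].
  by apply/forallP/idP => [/(_ 0) | Cu k]; rewrite ffunE.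
rewrite [RHS](partition_big (fun i => const_mx (u 0 i) : 'cV['F_2]_1) xpredT) //=.
apply: eq_bigr => a _; rewrite -prodr_const.
rewrite /count_col.
have -> : [set i | \col_k [ffun=> u] k 0 i == a] = [set i | const_mx (u 0 i) == a].
  by apply/setP => i; rewrite !inE; congr (_ == _); apply/colP => k; rewrite !mxE ffunE.
by apply: eq_big => [i | i]; rewrite inE // => /eqP ->.
Qed.

Lemma weight_enum1_eval (S : comAlgType K) (A B : S) n (C : {vspace 'rV['F_2]_n}) :
  genus1_eval A B (weight_enum R 1 C) = code_enum C A B.
Proof.
rewrite weight_enum1 rmorph_sum; apply: eq_bigr => u _.
by rewrite rmorph_prod; apply: eq_bigr => i _; apply: genus1_evalX.
Qed.

Lemma weight_enum1_homog n (C : {vspace 'rV['F_2]_n}) :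
  weight_enum R 1 C \is n.-homog.
Proof.
rewrite weight_enum1; apply: rpred_sum => u _.
suff H (F : 'I_n -> 'I_#|{: 'cV['F_2]_1}|) :
    (\prod_(i < n) 'X_(F i) : ring1) \is n.-homog by exact: H.
elim: n F {C u} => [|n IHn] F; first by rewrite big_ord0; apply: dhomog1.
have X_max : ('X_(F ord_max) : ring1) \is 1.-homog by rewrite dhomogX /= mdeg1.
have := dhomogM (IHn (F \o widen_ord (leqnSn n))) X_max.
by rewrite addn1 big_ord_recr.
Qed.

(** A homogeneous polynomial in two variables is recovered from its
    dehomogenization at (1, 'X), to which the study of binary forms applies. *)
Lemma genus1_eval_form (S : comAlgType K) d (p : ring1) (A B : S) :
  p \is d.-homog ->
  genus1_eval A B p = binary_form d (genus1_eval 1 'X p) A B.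
Proof.
move=> p_d; pose i1 := enum_rank (const_mx 1 : 'cV['F_2]_1).
have deg_i1 m : m \in msupp p -> (m i1 <= d)%N.
  by move=> /(dhomogP _ _ _ p_d) <-; rewrite /= mdegE big_genus1 leq_addl.
have evalE (S' : comAlgType K) (A' B' : S') : genus1_eval A' B' p =
    \sum_(m <- msupp p) p@_m *: (A' ^+ (d - m i1) * B' ^+ m i1).
  apply: eq_big_seq => m /(dhomogP _ _ _ p_d) dm; rewrite mulr_algl; congr (_ *: _).
  rewrite -dm /mmap1 /= mdegE !big_genus1 -/i1 addnK !enum_rankK eqxx ifN //.
  by apply/eqP => /colP/(_ 0); rewrite !mxE.
have coefE k : (genus1_eval 1 'X p)`_k = \sum_(m <- msupp p | m i1 == k) p@_m.
  rewrite evalE coef_sum [RHS]big_mkcond; apply: eq_bigr => m _.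
  by rewrite expr1n mul1r coefZ coefXn eq_sym; case: eqP; rewrite ?mulr1 ?mulr0.
rewrite evalE /binary_form; under [RHS]eq_bigr => k _ do rewrite coefE scaler_suml.
rewrite (exchange_big_dep xpredT) //=; apply: eq_big_seq => m /deg_i1 le_md.
by rewrite (big_pred1 (Ordinal (le_md : (m i1 < d.+1)%N))) // => k; rewrite -val_eqE eq_sym.
Qed.

Lemma size_genus1_eval d (p : ring1) : p \is d.-homog ->
  (size (genus1_eval 1 'X p : {poly K}) <= d.+1)%N.
Proof.
move=> p_d; rewrite (genus1_eval_form _ _ p_d) /binary_form.
apply: (leq_trans (size_sum _ _ _)); apply/bigmax_leqP => k _.
by rewrite expr1n mul1r (leq_trans (size_scale_leq _ _)) // size_polyXn.
Qed.

Lemma genus1_eval_inj d (p : ring1) : p \is d.-homog ->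
  genus1_eval 1 'X p = 0 :> {poly K} -> p = 0.
Proof.
move=> p_d P0; pose X (t : 'F_2) : ring1 := 'X_(enum_rank (const_mx t)).
(* The values in the polynomial ring itself, at the two variables. *)
have <- : genus1_eval (X 0) (X 1) p = p.
  rewrite [RHS]mpolyE; apply: eq_bigr => m _; rewrite mulr_algl -mmap1_id.
  congr (_ *: _); apply: mmap1_eq => i; rewrite /X -{2}(enum_valK i).
  have -> : enum_val i = const_mx ((enum_val i : 'cV['F_2]_1) 0 0).
    by apply/colP => j; rewrite mxE ord1.
  case: (F2P ((enum_val i : 'cV['F_2]_1) 0 0)) => ->; first by rewrite eqxx.
  by rewrite ifN //; apply/eqP => /colP/(_ 0); rewrite !mxE.
rewrite (genus1_eval_form _ _ p_d) P0 /binary_form big1 // => k _.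
by rewrite coef0 scale0r.
Qed.

(** The normalization by sqrt 2 makes the condition meaningful for
    inhomogeneous p, so that it passes to sums as well as to products. *)
Definition gleason_inv (p : ring1) := forall A B : {poly K},
  genus1_eval A ('i *: B) p = genus1_eval A B p /\
  genus1_eval ((sqrtC 2)^-1 *: (A + B)) ((sqrtC 2)^-1 *: (A - B)) p = genus1_eval A B p.

Lemma card_self_dual_sqrt n (C : {vspace 'rV['F_2]_n}) : self_dual C ->
  #|C|%:R = sqrtC 2 ^+ n :> K.
Proof.
move=> /card_self_dual /(congr1 (fun k => k%:R : K)); rewrite !natrX.
rewrite -[2 in RHS]sqrtCK -exprM mulnC exprM => /eqP.
by rewrite eqrXn2 ?exprn_ge0 ?sqrtC_ge0 ?ler0n // => /eqP.
Qed.

Lemma code_enumZ (S : comAlgType K) (A B : S) c n (C : {vspace 'rV['F_2]_n}) :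
  code_enum C (c *: A) (c *: B) = c ^+ n *: code_enum C A B.
Proof.
rewrite /code_enum scaler_sumr; apply: eq_bigr => u _.
rewrite -[n in c ^+ n]card_ord -prodr_const -scaler_prod.
by apply: eq_bigr => i _; case: ifP.
Qed.

Lemma type_II_gleason_inv n (C : {vspace 'rV['F_2]_n}) : type_II C ->
  gleason_inv (weight_enum R 1 C).
Proof.
move=> [sdC C4] A B; rewrite !weight_enum1_eval; split.
  apply: eq_bigr => u Cu; rewrite !prod_wt exprZn.
  have /dvdnP[k ->] := C4 u Cu.
  by rewrite mulnC exprM (exprM _ 2 2) sqrCi sqrrN expr1n expr1n scale1r.
rewrite code_enumZ macwilliams // mulr_natl -(scaler_nat #|C|).
rewrite card_self_dual_sqrt // scalerA.
by rewrite -exprMn mulVf ?sqrtC2_neq0 // expr1n scale1r.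
Qed.

Lemma ringB_gleason_inv (p : ring1) : ringB p -> gleason_inv p.
Proof.
elim=> [q [n [C [IIC ->]]] | c | q r _ IHq _ IHr | q r _ IHq _ IHr].
- exact: type_II_gleason_inv.
- by move=> A B; rewrite !genus1_evalC.
- by move=> A B; rewrite !rmorphD /=; case: (IHq A B) (IHr A B) => -> -> [-> ->].
by move=> A B; rewrite !rmorphM /=; case: (IHq A B) (IHr A B) => -> -> [-> ->].
Qed.

Lemma ringB_gleason d (p : ring1) : ringB p -> p \is d.-homog ->
  gleason_form d (genus1_eval 1 'X p : {poly K}).
Proof.
move=> Bp p_d; split; first exact: size_genus1_eval.
move=> A B; have [inv_i inv_s] := ringB_gleason_inv Bp A B.
rewrite -!(genus1_eval_form _ _ p_d); split=> //; rewrite -inv_s.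
rewrite (genus1_eval_form ((sqrtC 2)^-1 *: _) _ p_d) binary_formZ scalerA.
rewrite -exprMn mulfV ?sqrtC2_neq0 // expr1n scale1r.
by rewrite -(genus1_eval_form _ _ p_d).
Qed.

Lemma ringB_eq0 d (p : ring1) : ringB p -> p \is d.-homog ->
  let P := genus1_eval 1 'X p : {poly K} in
  P`_0 = 0 -> (d < 24)%N \/ d = 24 /\ P`_4 = 0 -> p = 0.
Proof.
move=> Bp p_d P P0 dP; apply: (genus1_eval_inj p_d).
exact: (gleason_eq0 (ringB_gleason Bp p_d) P0 dP).
Qed.

Lemma coef_weight_enum n (C : {vspace 'rV['F_2]_n}) k :
  (genus1_eval 1 'X (weight_enum R 1 C) : {poly K})`_k =
    #|[set u in C | wt u == k]|%:R.
Proof.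
rewrite weight_enum1_eval coef_sum -sum1dep_card natr_sum.
rewrite big_mkcond [RHS]big_mkcond; apply: eq_bigr => u _; case: (u \in C) => //=.
by rewrite prod_wt expr1n mul1r coefXn eq_sym; case: eqP.
Qed.

Lemma coef0_weight_enum n (C : {vspace 'rV['F_2]_n}) :
  (genus1_eval 1 'X (weight_enum R 1 C) : {poly K})`_0 = 1.
Proof.
rewrite coef_weight_enum (_ : [set _ in _ | _] = [set 0]) ?cards1 //.
apply/setP => u; rewrite !inE; apply/andP/eqP => [[_ /eqP/cards0_eq u0] | ->].
  by apply/rowP => i; have := in_set0 i; rewrite -u0 inE mxE => /negbFE/eqP.
by rewrite mem0v wtE big1 // => i _; rewrite mxE.
Qed.

(** By [ringB_eq0] an element of B is determined by one or two coefficients; it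
    suffices to match these with powers of the enumerator of d_8^+ and, in
    degree 24, with the enumerator of d_24^+. *)
Lemma ringB_sub_ringD d (p : ring1) : (d <= 24)%N -> ringB p -> p \is d.-homog ->
  ringD p.
Proof.
move=> le_d24 Bp p_d; pose W n := weight_enum R 1 (dplus n).
have DW n : (0 < n)%N -> (8 %| n)%N -> ringD (W n).
  by move=> n0 n8; apply: Gen_in; exists n.
have BW n : (8 %| n)%N -> ringB (W n).
  move=> n8; apply: Gen_in; exists n, (dplus n); split=> //.
  by apply: type_II_dplus => //; lia.
have homZ c q : q \is d.-homog -> c%:MP * q \is d.-homog.
  by rewrite mul_mpolyC; apply: dhomogZ.
set P := genus1_eval 1 'X p : {poly K}.
have homW8 k : W 8 ^+ k \is (8 * k).-homog by apply/dhomogMn/weight_enum1_homog.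
have W8_0 k : (genus1_eval 1 'X (W 8 ^+ k) : {poly K})`_0 = 1.
  by rewrite rmorphXn -horner_coef0 horner_exp horner_coef0 /= coef0_weight_enum expr1n.
have [lt_d24 | ] := ltnP d 24.
  have [/eqP P0|P0] := boolP (P`_0 == 0).
    rewrite (ringB_eq0 Bp p_d P0 (or_introl lt_d24)) -mpolyC0; apply: Gen_scalar.
  have /dvdnP[k def_d] := gleason_deg_mod8 (ringB_gleason Bp p_d) P0.
  rewrite mulnC in def_d.
  have q0 : p + (- P`_0)%:MP * W 8 ^+ k = 0.
    apply: ringB_eq0 (or_introl lt_d24).
    - apply: Gen_add => //; apply: Gen_mul; first exact: Gen_scalar.
      exact/subalgebra_genX/BW.
    - by apply: rpredD => //; apply: homZ; rewrite def_d; apply: homW8.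
    rewrite rmorphD /= genus1_evalZ coefD coefZ W8_0.
    by rewrite mulr1 subrr.
  have -> : p = (P`_0)%:MP * W 8 ^+ k.
    by apply/eqP; rewrite -subr_eq0 -mulNr -mpolyCN q0.
  by apply: Gen_mul; [apply: Gen_scalar | exact/subalgebra_genX/DW].
move=> ge_d24; have d24 : d = 24 by lia.
subst d.
pose N : K := (genus1_eval 1 'X (W 24) : {poly K})`_4.
have N42 : N - 42%:R != 0.
  rewrite /N coef_weight_enum subr_eq0 eqr_nat gtn_eqF //.
  exact: leq_trans (card_dplus_wt4 (isT : ~~ odd 24)).
have W8_4 : (genus1_eval 1 'X (W 8 ^+ 3) : {poly K})`_4 = 42%:R.
  rewrite rmorphXn /= gleason_form8_cube ?coef0_weight_enum //.
  exact: ringB_gleason (BW 8 isT) (weight_enum1_homog _).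
(* The solution of a + b = P`_0 and 42 a + N b = P`_4. *)
pose b := (P`_4 - 42%:R * P`_0) / (N - 42%:R); pose a := P`_0 - b.
have q0 : p + ((- a)%:MP * W 8 ^+ 3 + (- b)%:MP * W 24) = 0.
  apply: (@ringB_eq0 24).
  - apply: Gen_add => //; apply: Gen_add; apply: Gen_mul; try exact: Gen_scalar.
      exact/subalgebra_genX/BW.
    exact: BW.
  - apply: rpredD => //; apply: rpredD; apply: homZ; first exact: (homW8 3).
    exact: weight_enum1_homog.
  - rewrite !rmorphD /= !genus1_evalZ !coefD !coefZ W8_0.
    rewrite coef0_weight_enum /a; ring.
  right; split=> //.
  rewrite !rmorphD /= !genus1_evalZ !coefD !coefZ W8_4.
  by rewrite -/N -/P /a /b; field.
have -> : p = a%:MP * W 8 ^+ 3 + b%:MP * W 24.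
  by apply/eqP; rewrite -subr_eq0 opprD -!mulNr -!mpolyCN q0.
apply: Gen_add; apply: Gen_mul; try exact: Gen_scalar; last exact: DW.
exact/subalgebra_genX/DW.
Qed.

End Evaluation.

Lemma upto_degree_mono (R : realType) g (A B : enum_ring R g -> Prop) m p :
  (forall d q, (d <= m)%N -> A q -> q \is d.-homog -> B q) ->
  upto_degree A m p -> upto_degree B m p.
Proof.
move=> AB [f [Af ->]]; exists f; split=> // d; have [Afd fd] := Af d.
by split=> //; apply: AB Afd fd; rewrite -ltnS.
Qed.

Theorem theorem7p1 (R : realType) :
  (forall p : enum_ring R 1,
     upto_degree (@ringD R 1) 24 p <-> upto_degree (@ringA R 1) 24 p) /\
  (forall p : enum_ring R 1,
     upto_degree (@ringA R 1) 24 p <-> upto_degree (@ringB R 1) 24 p).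
Proof.
have DA (p : enum_ring R 1) : ringD p -> ringA p.
  apply: subalgebra_gen_mono => _ [n [n0 n8 ->]].
  by exists n, (dplus n); split=> //; left.
have AB (p : enum_ring R 1) : ringA p -> ringB p.
  apply: subalgebra_gen_mono => _ [n [C [n0 n8 [-> | [IIC _]] ->]]]; last by exists n, C.
  by exists n, (dplus n); split=> //; apply: type_II_dplus => //; lia.
by split=> p; split; apply: upto_degree_mono => d q le_d; eauto using ringB_sub_ringD.
Qed.
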